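(* Let $R$ be an integral domain, let $G$ be an infinite cyclic group, and let $x$ be a nonzero element of $RG$. Then the following are equivalent. (1) $xRG=\Phi(N)$ for some subgroup $N\neq 1$ of $G$. (2) $x=ug_1-ug_2$ for some unit $u$ of $R$ and some two elements $g_1,g_2$ of $G$. Moreover, if these are satisfied, then $xRG=\Phi(\langle h\rangle)$ and $RG/xRG\cong R(G/\langle h\rangle)$ as $R$-algebras, where $h=g_1g_2^{-1}$.
   Context: Groups are written multiplicatively. $RG$ is the group ring of $G$ over $R$. For a subgroup $N$ of $G$, $I(R,N)$ is the augmentation ideal of $RN$, i.e. the kernel of the $R$-algebra homomorphism $RN\to R$ sending every element of $N$ to $1$, and $\Phi(N)=I(R,N)RG$ is the ideal of $RG$ generated by $I(R,N)$. $\langle h\rangle$ denotes the subgroup generated by $h$. *)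

(* Defs.v *)
From HB Require Import structures.
From mathcomp Require Import all_boot all_order all_algebra.
From mathcomp Require Import finmap.
From mathcomp Require Import boolp classical_sets functions cardinality.
From mathcomp Require Import monalg.

Set Implicit Arguments.
Unset Strict Implicit.
Unset Printing Implicit Defensive.

Import GRing.Theory.
Local Open Scope fset_scope.
Local Open Scope ring_scope.
Local Open Scope quotient_scope.

(* Abelian groups are [zmodType]s and their subgroups [zmodClosed]s: the group
   law is written additively, so that gh, h^-1, h^n and 1 become g + h, - h,
   h *~ n and 0.  The basis element of RG attached to g is [gr R g] (see
   [grM] and [gr0]). *)

(* A synonym of {malg R[G]}: monalg only provides a product on {malg R[K]} for
   monoids K without nontrivial units. *)
Definition grpring (R : comNzRingType) (G : zmodType) := {malg R[G]}.

HB.instance Definition _ (R : comNzRingType) (G : zmodType) :=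
  GRing.Lmodule.copy (grpring R G) {malg R[G]}.

Definition gr (R : comNzRingType) (G : zmodType) (g : G) : grpring R G :=
  << 1 *g g >>.

Section GroupRing.
Variables (R : comNzRingType) (G : zmodType).
Local Notation RG := (grpring R G).
Implicit Types (a b c : RG) (g h : G) (r s : R).

Definition grmul a b : RG :=
  \sum_(g <- msupp a) \sum_(h <- msupp b) << a@_g * b@_h *g (g + h) >>.

Lemma grmulw (d1 d2 : {fset G}) a b : msupp a `<=` d1 -> msupp b `<=` d2 ->
  grmul a b = \sum_(g <- d1) \sum_(h <- d2) << a@_g * b@_h *g (g + h) >>.
Proof.
move=> le_d1 le_d2; rewrite /grmul (big_fset_incl _ le_d1) /=.
  apply/eq_bigr=> k1 _; apply/big_fset_incl => // k _ /mcoeff_outdom ->.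
  by rewrite mulr0 monalgU0.
move=> k _ /mcoeff_outdom ak.
by rewrite big1 => // k' _; rewrite ak mul0r monalgU0.
Qed.

Lemma grmulC : commutative grmul.
Proof.
move=> a b; rewrite /grmul exchange_big /=; apply/eq_bigr=> h _.
by apply/eq_bigr=> g _; rewrite mulrC addrC.
Qed.

Lemma grmul0 : left_zero 0 grmul.
Proof. by move=> a; rewrite /grmul msupp0 big_seq_fset0. Qed.

Lemma grmulDl : left_distributive grmul +%R.
Proof.
move=> a b c; rewrite [in RHS](grmulw (fsubsetUl _ (msupp b)) (fsubset_refl _)).
rewrite [in RHS](grmulw (fsubsetUr (msupp a) _) (fsubset_refl _)).
rewrite (grmulw (msuppD_le _ _) (fsubset_refl _)).
rewrite -big_split /=; apply/eq_bigr=> k1 _.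
rewrite -big_split /=; apply/eq_bigr=> k2 _.
by rewrite mcoeffD mulrDl monalgUD.
Qed.

Lemma grmulDr : right_distributive grmul +%R.
Proof. by move=> a b c; rewrite !(grmulC a) grmulDl. Qed.

Lemma grmulUU r s g h :
  grmul << r *g g >> << s *g h >> = << r * s *g (g + h) >>.
Proof. by rewrite (grmulw msuppU_le msuppU_le) !big_seq_fset1 !mcoeffUU. Qed.

Lemma grmul_suml (I : Type) (t : seq I) (F : I -> RG) b :
  grmul (\sum_(i <- t) F i) b = \sum_(i <- t) grmul (F i) b.
Proof.
exact: (big_morph (grmul^~ b) (fun _ _ => grmulDl _ _ _) (grmul0 _)).
Qed.

Lemma grmul_sumr (I : Type) (t : seq I) (F : I -> RG) a :
  grmul a (\sum_(i <- t) F i) = \sum_(i <- t) grmul a (F i).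
Proof. by rewrite grmulC grmul_suml; apply/eq_bigr=> i _; rewrite grmulC. Qed.

Lemma grmulA : associative grmul.
Proof.
move=> a b c; rewrite [a]monalgE [b]monalgE [c]monalgE.
rewrite !(grmul_suml (msupp a)); apply/eq_bigr=> g _.
rewrite (grmul_suml (msupp b)) !(grmul_sumr (msupp b)) (grmul_suml (msupp b)).
apply/eq_bigr=> h _.
rewrite !(grmul_sumr (msupp c)); apply/eq_bigr=> k _.
by rewrite !grmulUU mulrA addrA.
Qed.

Lemma grmul1 : left_id (gr R 0) grmul.
Proof.
move=> a; rewrite [a]monalgE grmul_sumr; apply/eq_bigr=> g _.
by rewrite grmulUU mul1r add0r.
Qed.

Lemma gr_neq0 : gr R (0 : G) != 0.
Proof. by rewrite monalgU_eq0 oner_eq0. Qed.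

HB.instance Definition _ := GRing.Zmodule_isComNzRing.Build RG
  grmulA grmulC grmul1 grmulDl gr_neq0.

Lemma grZU r s g : r *: (<< s *g g >> : RG) = << r * s *g g >>.
Proof.
apply/malgP=> k; rewrite [LHS](mcoeffZ r (<< s *g g >> : {malg R[G]})).
by rewrite !mcoeffU mulrnAr.
Qed.

Lemma grscaleAl r a b : r *: (a * b) = (r *: a) * b.
Proof.
have scE c : r *: c = (<< r *g 0 >> : RG) * c.
  rewrite [c]monalgE scaler_sumr [RHS]grmul_sumr; apply/eq_bigr=> g _.
  by rewrite grmulUU add0r; exact: grZU.
by rewrite !scE mulrA.
Qed.

HB.instance Definition _ := GRing.Lmodule_isLalgebra.Build R RG grscaleAl.
HB.instance Definition _ := GRing.Lalgebra_isComAlgebra.Build R RG.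

Lemma gr0 : gr R (0 : G) = 1. Proof. by []. Qed.

Lemma grM g h : gr R g * gr R h = gr R (g + h).
Proof. by rewrite [LHS]grmulUU mulr1. Qed.

Lemma grE a : a = \sum_(g <- msupp a) a@_g *: gr R g.
Proof.
by rewrite [LHS]monalgE; apply/eq_bigr=> g _; rewrite [RHS]grZU mulr1.
Qed.

Definition aug a : R := \sum_(g <- msupp a) a@_g.

Lemma augE a : aug a = mmap idfun (fun=> 1) (a : {malg R[G]}).
Proof. by rewrite /aug mmapE; apply/eq_bigr=> g _; rewrite mulr1. Qed.

Lemma aug_is_zmod_morphism : zmod_morphism aug.
Proof.
move=> a b; rewrite !augE.
exact: (raddfB (mmap (idfun : {additive R -> R}) (fun _ : G => 1))).
Qed.
HB.instance Definition _ :=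
  GRing.isZmodMorphism.Build RG R aug aug_is_zmod_morphism.

Lemma augU r g : aug << r *g g >> = r.
Proof. by rewrite augE mmapU mulr1. Qed.

Lemma aug_gr g : aug (gr R g) = 1.
Proof. exact: augU. Qed.

Lemma aug_is_monoid_morphism : monoid_morphism aug.
Proof.
split=> [|a b]; first exact: aug_gr.
rewrite [a]monalgE [b]monalgE [_ * _]grmul_suml !raddf_sum mulr_suml.
apply/eq_bigr=> g _; rewrite grmul_sumr !raddf_sum mulr_sumr.
by apply/eq_bigr=> h _; rewrite grmulUU /= !augU.
Qed.
HB.instance Definition _ :=
  GRing.isMonoidMorphism.Build RG R aug aug_is_monoid_morphism.

Lemma aug_is_scalable : scalable_for *%R aug.
Proof.
move=> r a; rewrite [a]monalgE scaler_sumr !raddf_sum mulr_sumr.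
by apply/eq_bigr=> g _; rewrite grZU /= !augU.
Qed.
HB.instance Definition _ :=
  GRing.isScalable.Build R RG R *%R aug aug_is_scalable.

End GroupRing.

Section CyclicSubgroup.
Variable (G : zmodType).

Definition cyc (h : G) : {pred G} := fun g => `[< exists n : int, g = h *~ n >].

Lemma cyc_zmod_closed h : zmod_closed (cyc h).
Proof.
split=> [|_ _ /asboolP[m ->] /asboolP[n ->]]; apply/asboolP.
  by exists 0; rewrite mulr0z.
by exists (m - n); rewrite mulrzBr.
Qed.
HB.instance Definition _ h :=
  GRing.isZmodClosed.Build G (cyc h) (cyc_zmod_closed h).

Definition infinite_cyclic : Prop :=
  (exists g : G, forall x, x \in cyc g) /\ infinite_set [set: G].

End CyclicSubgroup.

(* Unlike [idealr], these ideals may be improper. *)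
HB.mixin Record isIdealPred (A : comNzRingType) (S : A -> bool) := {
  ideal_mulr_subproof : forall a, {in S, forall u, a * u \in S}
}.

#[short(type="idealPred")]
HB.structure Definition IdealPred (A : comNzRingType) :=
  {S of GRing.ZmodClosed A S & isIdealPred A S}.

Section Ideals.
Variable (A : comNzRingType).

Definition princ_ideal (x : A) : {pred A} := fun y => `[< exists a, y = x * a >].

Lemma princ_ideal_zmod_closed x : zmod_closed (princ_ideal x).
Proof.
split=> [|_ _ /asboolP[a ->] /asboolP[b ->]]; apply/asboolP.
  by exists 0; rewrite mulr0.
by exists (a - b); rewrite mulrBr.
Qed.
HB.instance Definition _ x :=
  GRing.isZmodClosed.Build A (princ_ideal x) (princ_ideal_zmod_closed x).

Lemma princ_ideal_mulr x a :
  {in princ_ideal x, forall u, a * u \in princ_ideal x}.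
Proof.
by move=> _ /asboolP[b ->]; apply/asboolP; exists (a * b); rewrite mulrCA.
Qed.
HB.instance Definition _ x :=
  isIdealPred.Build A (princ_ideal x) (@princ_ideal_mulr x).

Definition gen_ideal (S : {pred A}) : {pred A} := fun y =>
  `[< exists2 t : seq (A * A), {in t, forall p, p.1 \in S}
        & y = \sum_(p <- t) p.1 * p.2 >].

End Ideals.

Section Augmentation.
Variables (R : comNzRingType) (G : zmodType).

(* RN, seen inside RG *)
Definition subgrpring (N : zmodClosed G) : {pred grpring R G} :=
  fun a => all (fun g => g \in N) (msupp a).

Definition aug_ideal (N : zmodClosed G) : {pred grpring R G} :=
  fun a => (a \in subgrpring N) && (aug a == 0).

Definition Phi (N : zmodClosed G) : {pred grpring R G} :=
  gen_ideal (aug_ideal N).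

End Augmentation.

Arguments subgrpring R {G} N.
Arguments aug_ideal R {G} N.
Arguments Phi R {G} N.

(* A/I as an R-algebra, as a synonym of the additive quotient [Quotient.quot I].  It may
   be the zero ring, which [algType] excludes, so it is a ring and an R-module
   satisfying [algquot_scaleAl]. *)
Definition algquot (R : comNzRingType) (A : comAlgType R) (I : idealPred A) :=
  Quotient.quot I.

Section AlgQuot.
Variables (R : comNzRingType) (A : comAlgType R) (I : idealPred A).
Local Notation Q := (algquot I).
Implicit Types (r s : R) (x y z : Q) (a b : A).

HB.instance Definition _ := GRing.Zmodule.copy Q (Quotient.quot I).

Definition algpi a : Q := \pi_(Quotient.quot I) a.

Lemma algpi_eq a b : (algpi a == algpi b) = (a - b \in I).
Proof. by rewrite Quotient.idealrBE. Qed.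

Lemma algpi_repr x : algpi (repr (x : Quotient.quot I)) = x.
Proof. exact: reprK. Qed.

Lemma algpi_surj x : exists a, x = algpi a.
Proof. by exists (repr (x : Quotient.quot I)); rewrite algpi_repr. Qed.

Lemma algpi_is_zmod_morphism : zmod_morphism algpi.
Proof. exact: (raddfB (\pi_(Quotient.quot I))). Qed.
HB.instance Definition _ :=
  GRing.isZmodMorphism.Build A Q algpi algpi_is_zmod_morphism.

Definition algquot_mul x y : Q :=
  algpi (repr (x : Quotient.quot I) * repr (y : Quotient.quot I)).

Definition algquot_scale r x : Q := algpi (r *: repr (x : Quotient.quot I)).

Lemma algpi_reprB a : repr (algpi a : Quotient.quot I) - a \in I.
Proof. by rewrite -algpi_eq algpi_repr. Qed.

Lemma algpiM a b : algquot_mul (algpi a) (algpi b) = algpi (a * b).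
Proof.
apply/eqP; rewrite algpi_eq.
set a' := repr _; set b' := repr _.
have -> : a' * b' - a * b = a' * (b' - b) + b * (a' - a).
  by rewrite !mulrBr addrA [b * a']mulrC subrK [b * a]mulrC.
by rewrite rpredD // ideal_mulr_subproof // algpi_reprB.
Qed.

Lemma algpiZ_subproof r a : algquot_scale r (algpi a) = algpi (r *: a).
Proof.
apply/eqP; rewrite algpi_eq -scalerBr -mulr_algl.
by rewrite ideal_mulr_subproof // algpi_reprB.
Qed.

Lemma algquot_mulA : associative algquot_mul.
Proof.
move=> x y z; case: (algpi_surj x) (algpi_surj y) (algpi_surj z).
by move=> a -> [b ->] [c ->]; rewrite !algpiM mulrA.
Qed.

Lemma algquot_mulC : commutative algquot_mul.
Proof.
move=> x y; case: (algpi_surj x) (algpi_surj y) => a -> [b ->].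
by rewrite !algpiM mulrC.
Qed.

Lemma algquot_mul1 : left_id (algpi 1) algquot_mul.
Proof. by move=> x; case: (algpi_surj x) => a ->; rewrite algpiM mul1r. Qed.

Lemma algquot_mulDl : left_distributive algquot_mul +%R.
Proof.
move=> x y z; case: (algpi_surj x) (algpi_surj y) (algpi_surj z).
by move=> a -> [b ->] [c ->]; rewrite -raddfD !algpiM mulrDl raddfD.
Qed.

HB.instance Definition _ := GRing.Zmodule_isComPzRing.Build Q
  algquot_mulA algquot_mulC algquot_mul1 algquot_mulDl.

Lemma algquot_scaleA r s x :
  algquot_scale r (algquot_scale s x) = algquot_scale (r * s) x.
Proof.
by case: (algpi_surj x) => a ->; rewrite !algpiZ_subproof scalerA.
Qed.

Lemma algquot_scale1 : left_id 1 algquot_scale.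
Proof.
by move=> x; case: (algpi_surj x) => a ->; rewrite algpiZ_subproof scale1r.
Qed.

Lemma algquot_scaleDr : right_distributive algquot_scale +%R.
Proof.
move=> r x y; case: (algpi_surj x) (algpi_surj y) => a -> [b ->].
by rewrite -raddfD !algpiZ_subproof scalerDr raddfD.
Qed.

Lemma algquot_scaleDl x : {morph algquot_scale^~ x : r s / r + s}.
Proof.
move=> r s; case: (algpi_surj x) => a ->.
by rewrite !algpiZ_subproof scalerDl raddfD.
Qed.

HB.instance Definition _ := GRing.Zmodule_isLmodule.Build R Q
  algquot_scaleA algquot_scale1 algquot_scaleDr algquot_scaleDl.

Lemma algpi_is_monoid_morphism : monoid_morphism algpi.
Proof. by split=> // a b; rewrite -algpiM. Qed.
HB.instance Definition _ :=
  GRing.isMonoidMorphism.Build A Q algpi algpi_is_monoid_morphism.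

Lemma algpi_is_scalable : scalable algpi.
Proof. by move=> r a; rewrite -algpiZ_subproof. Qed.
HB.instance Definition _ :=
  GRing.isScalable.Build R A Q *:%R algpi algpi_is_scalable.

Lemma algquot_scaleAl r x y : r *: (x * y) = (r *: x) * y.
Proof.
case: (algpi_surj x) (algpi_surj y) => a -> [b ->].
by rewrite -(rmorphM algpi) -!(linearZ_LR algpi) -(rmorphM algpi) scalerAl.
Qed.

End AlgQuot.

(* Main.v *)
Require Import Defs.
From HB Require Import structures.
From mathcomp Require Import all_boot all_order all_algebra.
From mathcomp Require Import boolp classical_sets functions cardinality.
From mathcomp Require Import monalg.
From mathcomp Require Import finmap.
From mathcomp Require Import zify.

Set Implicit Arguments.
Unset Strict Implicit.
Unset Printing Implicit Defensive.

Import GRing.Theory Num.Theory Order.TTheory.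
Local Open Scope ring_scope.

(** In exponential notation, everything rests on three facts.

    For any subgroup N of any abelian group G, extending the quotient map
    G -> G/N linearly gives a surjective R-algebra morphism RG -> R(G/N), and
    its kernel is Phi(N) ([grproj_ker]).  Choosing a representative r(g) of
    each coset gN splits this morphism linearly, and an element a of the kernel
    equals the sum of the a_g (g - r(g)) = a_g (g r(g)^-1 - 1) r(g), where
    g r(g)^-1 lies in N.  Hence RG/I is R(G/N) as soon as I = Phi(N)
    ([algquot_Phi]).

    If N is generated by h, then Phi(N) is generated by h - 1
    ([Phi_cyclic]), because h - 1 divides each h^n - 1.  When
    x = u g1 - u g2 = u g2 (g1 g2^-1 - 1) with u a unit, x is associated to
    h - 1 for h = g1 g2^-1; this gives (2) => (1) and the final claims.

    Conversely, every subgroup of the cyclic group G is generated by some h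
    ([sub_cyclic]), so (1) says that x and h - 1 generate the same ideal.
    Since G is isomorphic to the ordered group Z and R is a domain, leading
    coefficients multiply: RG is a domain ([grpring_mulf_eq0]), hence x is
    a (h - 1) with a invertible; comparing the leading and the trailing terms
    of a and of its inverse shows that a = u k for a unit u of R and some k in
    G ([grpring_unit]).  So x = u (h k) - u k. *)

(** * Linear extension and functoriality of group rings *)

Section LinearExtension.
Variables (R : comNzRingType) (G : zmodType) (V : lmodType R) (F : G -> V).
Local Notation RG := (grpring R G).

(** RG is free on G: this is the linear map sending each basis element [gr R g]
    to [F g]. *)
Definition grlin (a : RG) : V := \sum_(g <- msupp a) a@_g *: F g.

(** Summing over any set that contains the support lets two elements be
    compared over a common index set. *)
Lemma grlinw (d : {fset G}) (a : RG) : (msupp a `<=` d)%fset ->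
  grlin a = \sum_(g <- d) a@_g *: F g.
Proof.
move=> le_d; apply: big_fset_incl => // g _ /mcoeff_outdom ->.
by rewrite scale0r.
Qed.

Lemma grlin_is_zmod_morphism : zmod_morphism grlin.
Proof.
move=> a b; pose d := (msupp a `|` msupp b)%fset.
rewrite (@grlinw d a) ?fsubsetUl // (@grlinw d b) ?fsubsetUr //.
rewrite (@grlinw d) ?msuppB_le //.
rewrite -sumrB; apply: eq_bigr => g _.
by rewrite -scalerBl [(a - b)@_g]mcoeffB.
Qed.
HB.instance Definition _ :=
  GRing.isZmodMorphism.Build RG V grlin grlin_is_zmod_morphism.

Lemma grlin_is_scalable : scalable grlin.
Proof.
move=> r a; rewrite (@grlinw (msupp a)) ?msuppZ_le //.
rewrite scaler_sumr; apply: eq_bigr => g _.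
by rewrite scalerA [(r *: a)@_g]mcoeffZ.
Qed.
HB.instance Definition _ :=
  GRing.isScalable.Build R RG V *:%R grlin grlin_is_scalable.

Lemma grlin_gr g : grlin (gr R g) = F g.
Proof.
rewrite (@grlinw [fset g]%fset) ?msuppU_le //.
by rewrite big_seq_fset1 mcoeffUU scale1r.
Qed.

End LinearExtension.

Section Functoriality.
Variables (R : comNzRingType) (G H : zmodType) (phi : {additive G -> H}).

Definition grmap : grpring R G -> grpring R H := grlin (fun g => gr R (phi g)).

HB.instance Definition _ := GRing.Linear.copy grmap grmap.

Lemma grmap_gr g : grmap (gr R g) = gr R (phi g).
Proof. exact: grlin_gr. Qed.

Lemma grmap_is_monoid_morphism : monoid_morphism grmap.
Proof.
split=> [|a b]; first by rewrite -gr0 grmap_gr raddf0.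
have mapE c : grmap c = \sum_(g <- msupp c) c@_g *: gr R (phi g) by [].
rewrite {1}(grE a) {1}(grE b) [grmap a]mapE [grmap b]mapE !mulr_suml raddf_sum.
apply: eq_bigr => g _; rewrite !mulr_sumr raddf_sum; apply: eq_bigr => h _.
by rewrite -!scalerAl -!scalerAr !grM /= !(linearZ_LR grmap) /= grmap_gr raddfD.
Qed.
HB.instance Definition _ :=
  GRing.isMonoidMorphism.Build _ _ grmap grmap_is_monoid_morphism.

End Functoriality.

(** * The quotient of RG by Phi(N) *)

Section AugmentationKernel.
Variables (R : comNzRingType) (G : zmodType).
Local Notation RG := (grpring R G).

Lemma aug_idealP (N : zmodClosed G) g : g \in N ->
  gr R g - 1 \in aug_ideal R N.
Proof.
move=> Ng; apply/andP; split; last by rewrite rmorphB rmorph1 /= aug_gr subrr.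
apply/allP => k /(fsubsetP (msuppB_le _ _)).
rewrite in_fsetU => /orP[] /(fsubsetP msuppU_le); rewrite inE => /eqP-> //.
exact: rpred0.
Qed.

(** The augmentation ideal of RN is spanned by the g - 1: the sum of the
    coefficients of [a], which vanishes, is what is subtracted. *)
Lemma aug_ideal_expand (N : zmodClosed G) (a : RG) : a \in aug_ideal R N ->
  a = \sum_(g <- msupp a) a@_g *: (gr R g - 1) /\
  {in msupp a, forall g, g \in N}.
Proof.
move=> /andP[/allP Na /eqP a0]; split=> //.
under eq_bigr do rewrite scalerBr.
by rewrite sumrB -scaler_suml -/(aug a) a0 scale0r subr0 -grE.
Qed.

Variable N : zmodClosed G.
Local Notation pi := (\pi_(Quotient.quot N)%qT : G -> Quotient.quot N).

Definition grproj : RG -> grpring R (Quotient.quot N) := grmap pi.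
HB.instance Definition _ := GRing.LRMorphism.copy grproj grproj.

(** A linear section of [grproj]; it is not multiplicative, since [repr] is not
    a homomorphism. *)
Definition grlift : grpring R (Quotient.quot N) -> RG :=
  grlin (fun q => gr R (repr q)).
HB.instance Definition _ := GRing.Linear.copy grlift grlift.

Lemma grliftK : cancel grlift grproj.
Proof.
move=> b; rewrite [in RHS](grE b) {1}(grE b).
rewrite (linear_sum grlift) (linear_sum grproj) /=.
apply: eq_bigr => q _; rewrite (linearZ_LR grlift) (linearZ_LR grproj) /=.
rewrite [grlift _]grlin_gr.
by rewrite [grproj _]grmap_gr /= reprK.
Qed.

(** An element [a] of the kernel is its own difference with
    [grlift (grproj a)], which termwise is a combination of the g - r(g) for
    r(g) the representative of the coset of g. *)
Lemma grproj_ker a : (grproj a == 0) = (a \in Phi R N).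
Proof.
apply/eqP/asboolP => [a0|[t tN ->]].
  pose r g := repr (pi g).
  exists [seq (gr R (g - r g) - 1, a@_g *: gr R (r g)) | g <- msupp a].
    move=> _ /mapP[g _ ->]; apply: aug_idealP.
    by rewrite Quotient.idealrBE /r reprK.
  rewrite big_map /=.
  transitivity (a - grlift (grproj a)); first by rewrite a0 raddf0 subr0.
  rewrite {1 2}(grE a) (linear_sum grproj) (linear_sum grlift) -sumrB /=.
  apply: eq_bigr => g _.
  rewrite (linearZ_LR grproj) (linearZ_LR grlift) /=.
  rewrite [grproj _]grmap_gr [grlift _]grlin_gr.
  by rewrite -scalerBr -scalerAr mulrBl grM subrK mul1r.
rewrite (linear_sum grproj) big_seq big1 // => -[u v] /tN /=.
move=> /aug_ideal_expand[uE uN].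
rewrite rmorphM /= uE (linear_sum grproj) big_seq big1 ?mul0r // => g /uN Ng.
rewrite (linearZ_LR grproj) rmorphB rmorph1 /= [grproj _]grmap_gr /=.
suff -> : pi g = 0 by rewrite gr0 subrr scaler0.
by rewrite -(raddf0 pi); apply/eqP; rewrite -Quotient.idealrBE subr0.
Qed.

(** The first isomorphism theorem for [grproj], for an ideal [I] that need only
    have the same elements as Phi(N); [grlift] provides the inverse. *)
Lemma algquot_Phi (I : idealPred RG) : I =i Phi R N ->
  exists f : {rmorphism algquot I -> grpring R (Quotient.quot N)},
    scalable f /\ bijective f.
Proof.
move=> eqI; pose f (q : algquot I) := grproj (repr (q : Quotient.quot I)).
have fE a : f (algpi I a) = grproj a.
  by apply/eqP; rewrite -subr_eq0 -rmorphB grproj_ker -eqI algpi_reprB.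
have fB : zmod_morphism f.
  move=> p q; have [a ->] := algpi_surj p; have [b ->] := algpi_surj q.
  by rewrite -rmorphB !fE rmorphB.
have fM : monoid_morphism f.
  split=> [|p q]; first by rewrite -(rmorph1 (algpi I)) fE rmorph1.
  have [a ->] := algpi_surj p; have [b ->] := algpi_surj q.
  by rewrite -rmorphM !fE rmorphM.
pose fa := GRing.isZmodMorphism.Build _ _ f fB.
pose fm := GRing.isMonoidMorphism.Build _ _ f fM.
pose fr : {rmorphism _ -> _} := HB.pack f fa fm.
exists fr; split=> [r p|].
  have [a ->] := algpi_surj p.
  by rewrite -(linearZ_LR (algpi I)) /= !fE (linearZ_LR grproj).
exists (algpi I \o grlift) => [p|b] /=; last by rewrite fE grliftK.
have [a ->] := algpi_surj p.
apply/eqP; rewrite fE algpi_eq eqI -grproj_ker rmorphB /= grliftK.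
by rewrite subrr.
Qed.

End AugmentationKernel.

(** * Phi of a cyclic subgroup is principal *)

Section PhiCyclic.
Variables (R : comNzRingType) (G : zmodType).
Local Notation RG := (grpring R G).

Lemma princ_ideal_gen (x : RG) : x \in princ_ideal x.
Proof. by apply/asboolP; exists 1; rewrite mulr1. Qed.

(** The geometric sum, extended to negative exponents by
    h^-k - 1 = - h^-k (h^k - 1). *)
Lemma gr_mulrz_sub1 h n : gr R (h *~ n) - 1 \in princ_ideal (gr R (h : G) - 1).
Proof.
have pos k : gr R (h *+ k) - 1 \in princ_ideal (gr R h - 1).
  elim: k => [|k IHk]; first by rewrite mulr0n gr0 subrr rpred0.
  have -> : gr R (h *+ k.+1) - 1 =
      gr R h * (gr R (h *+ k) - 1) + (gr R h - 1).
    by rewrite mulrBr grM -mulrS mulr1 addrA subrK.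
  by rewrite rpredD ?ideal_mulr_subproof ?princ_ideal_gen.
case: n => k; first exact: pos.
rewrite NegzE mulrNz -pmulrn.
have -> : gr R (- (h *+ k.+1)) - 1 =
    - gr R (- (h *+ k.+1)) * (gr R (h *+ k.+1) - 1).
  by rewrite mulNr mulrBr grM addNr gr0 mulr1 opprB.
by rewrite ideal_mulr_subproof ?pos.
Qed.

(** The generators g - 1 of Phi(N) are all divisible by h - 1, itself one of
    them. *)
Lemma Phi_cyclic (N : zmodClosed G) h : N =i cyc h ->
  princ_ideal (gr R h - 1) =i Phi R N.
Proof.
move=> NE y; apply/idP/idP => [/asboolP[c ->]|/asboolP[t tN ->]].
  apply/asboolP; exists [:: (gr R h - 1, c)]; last by rewrite big_seq1.
  move=> _ /predU1P[->|//]; apply: aug_idealP; rewrite NE.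
  by apply/asboolP; exists 1; rewrite mulr1z.
rewrite big_seq rpred_sum // => p /tN /aug_ideal_expand[pE pN].
rewrite mulrC pE ideal_mulr_subproof // big_seq rpred_sum // => g /pN.
rewrite NE => /asboolP[n ->].
by rewrite -mulr_algl ideal_mulr_subproof ?gr_mulrz_sub1.
Qed.

End PhiCyclic.

(** * Cyclic groups *)

Section CyclicGroups.
Variable G : zmodType.

(** The generator is the least positive power of [g] in [N], if there is one;
    otherwise [N] is trivial. *)
Lemma sub_cyclic (g : G) (N : zmodClosed G) : (forall x, x \in cyc g) ->
  exists h, N =i cyc h.
Proof.
move=> gG; have [Nex|Nno] := pselect (exists n, g *+ n.+1 \in N).
  have [d Nd dmin] := ex_minnP Nex.
  exists (g *+ d.+1) => x; apply/idP/asboolP => [|[m ->]]; last exact: rpredMz.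
  have /asboolP[m ->] := gG x => Nm.
  exists (m %/ d.+1)%Z; rewrite pmulrn -mulrzA.
  have mE := divz_eq m d.+1; have m0 : (0 <= m %% d.+1)%Z by exact: modz_ge0.
  have md : (m %% d.+1 < d.+1)%Z by exact: ltz_pmod.
  have Nr : g *~ (m %% d.+1)%Z \in N.
    have -> : (m %% d.+1)%Z = m - d.+1%:Z * (m %/ d.+1)%Z by lia.
    by rewrite mulrzBr mulrzA; apply: rpredB Nm _; apply: rpredMz.
  case: (m %% d.+1)%Z mE m0 md Nr => [[|r]|r] //= mE _ rd Nr.
    by rewrite {1}mE addr0 mulrC.
  by have := dmin _ Nr; lia.
exists 0 => x; apply/idP/asboolP => [|[m ->]]; last by rewrite mul0rz rpred0.
have /asboolP[m ->] := gG x; case: m => [[|m]|m] Nm; first by exists 0.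
  by case: Nno; exists m.
by case: Nno; exists m; move: Nm; rewrite NegzE mulrNz rpredN.
Qed.

(** The discrete logarithm, which transports the order of Z to [G].  It exists
    because g^n = 1 with n nonzero would leave only the |n| elements g^k with
    k < |n|. *)
Lemma infinite_cyclic_deg : infinite_cyclic G ->
  exists deg : G -> int, injective deg /\ {morph deg : x y / x + y}.
Proof.
move=> [[g gG] Ginf].
have g_free n : g *~ n = 0 -> n = 0.
  move=> gn0; apply: contrapT => /eqP n0; apply: Ginf.
  apply: (@sub_finite_set _ _ ((fun k => g *+ k) @` `I_(`|n|%N)));
    last exact/finite_image/finite_II.
  move=> x _; have /asboolP[m ->] := gG x.
  have m0 : (0 <= m %% n)%Z by exact: modz_ge0.
  have := ltz_mod m n0; exists (`|(m %% n)%Z|%N); first by rewrite /=; lia.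
  rewrite pmulrn gez0_abs // [in RHS](divz_eq m n) [RHS]mulrzDr.
  by rewrite [(_ %/ _)%Z * _]mulrC [in RHS]mulrzA gn0 mul0rz add0r.
have inj m n : g *~ m = g *~ n -> m = n.
  move=> e; apply/eqP; rewrite -subr_eq0; apply/eqP/g_free.
  by rewrite mulrzBr e subrr.
have [deg degE] := choice (fun x => asboolP _ (gG x)).
exists deg; split=> [x y exy|x y]; first by rewrite (degE x) exy -degE.
by apply: inj; rewrite mulrzDr -!degE.
Qed.

End CyclicGroups.

(** * Leading terms in the group ring of an ordered group *)

Section Degree.
Variables (R : idomainType) (G : zmodType) (deg : G -> int).
Local Notation RG := (grpring R G).
Hypotheses (deg_inj : injective deg) (degD : {morph deg : g h / g + h}).

Definition is_top (a : RG) m :=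
  m \in msupp a /\ {in msupp a, forall g, deg g <= deg m}.

Lemma top_exists a : a != 0 -> exists m, is_top a m.
Proof.
move=> a0; have /fset0Pn[m0 am0] : msupp a != fset0%fset.
  apply: contra a0 => /eqP e; apply/eqP/malgP => g.
  by rewrite mcoeff0 mcoeff_outdom ?e.
pose maxP := @Order.TotalTheory.arg_maxP.
case: (maxP _ _ _ [` am0]%fset xpredT (deg \o val)) => //=.
move=> m _ mmax; exists (val m); split; first exact: valP.
by move=> g ag; exact: (mmax [` ag]%fset).
Qed.

(** No cancellation can occur at [m + n]: it splits as a sum of an element of
    the support of [a] and one of the support of [b] only as [m] and [n]. *)
Lemma mcoeffM_top a b m n : is_top a m -> is_top b n ->
  (a * b)@_(m + n) = a@_m * b@_n.
Proof.
move=> [am amax] [bn bmax].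
rewrite [a * b]/(grmul a b) /grmul raddf_sum /=.
rewrite (bigD1_seq m) ?fset_uniq //= [X in _ + X]big_seq_cond.
have uniq_top g h : g \in msupp a -> h \in msupp b -> g + h = m + n ->
    g = m /\ h = n.
  move=> /amax gm /bmax hn /(congr1 deg); rewrite !degD => e.
  by split; apply: deg_inj; lia.
rewrite [X in _ + X]big1 => [|g /andP[ag gm]]; rewrite ?addr0 raddf_sum /=.
  rewrite (bigD1_seq n) ?fset_uniq //= mcoeffUU big_seq_cond big1 ?addr0 //.
  move=> h /andP[bh hn]; rewrite mcoeffU; case: eqP => // e.
  by move: hn; rewrite (uniq_top _ _ am bh e).2 eqxx.
rewrite big_seq big1 // => h bh; rewrite mcoeffU; case: eqP => // e.
by move: gm; rewrite (uniq_top _ _ ag bh e).1 eqxx.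
Qed.

Lemma top_mul a b m n : is_top a m -> is_top b n -> m + n \in msupp (a * b).
Proof.
move=> am bn; rewrite -mcoeff_neq0 (mcoeffM_top am bn) mulf_neq0 //.
  by rewrite mcoeff_neq0 am.1.
by rewrite mcoeff_neq0 bn.1.
Qed.

Lemma grpring_mulf_eq0 (a b : RG) : a * b = 0 -> a = 0 \/ b = 0.
Proof.
have [->|/top_exists[m am]] := eqVneq a 0; first by left.
have [->|/top_exists[n bn]] := eqVneq b 0; first by right.
by move=> ab0; have := top_mul am bn; rewrite ab0 msupp0.
Qed.

End Degree.

(** The leading term of [a * b] is the product of those of [a] and [b], and the
    same holds for the trailing ones, which are the leading ones for the degree
    [- deg].  As [a * b = 1], both sit at the neutral element, so the widths
    of the supports of [a] and [b], which are nonnegative, add up to zero. *)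
Lemma grpring_unit (R : idomainType) (G : zmodType) (deg : G -> int)
    (a b : grpring R G) :
  injective deg -> {morph deg : g h / g + h} -> a * b = 1 ->
  exists (u : R) (g : G), u \is a GRing.unit /\ a = u *: gr R g.
Proof.
move=> deg_inj degD ab1; pose deg' g := - deg g.
have deg'_inj : injective deg' by move=> g h /oppr_inj/deg_inj.
have deg'D : {morph deg' : g h / g + h}.
  by move=> g h; rewrite /deg' degD opprD.
have a0 : a != 0.
  apply/eqP => a0; move: ab1; rewrite a0 mul0r => /esym/eqP.
  by rewrite oner_eq0.
have b0 : b != 0.
  apply/eqP => b0; move: ab1; rewrite b0 mulr0 => /esym/eqP.
  by rewrite oner_eq0.
have supp1 g : g \in msupp (a * b) -> g = 0.
  by rewrite ab1 => /(fsubsetP msuppU_le); rewrite inE => /eqP.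
have [m am] := top_exists deg a0; have [n bn] := top_exists deg b0.
have [m' am'] := top_exists deg' a0; have [n' bn'] := top_exists deg' b0.
have mn : m + n = 0 := supp1 _ (top_mul deg_inj degD am bn).
have mn' : m' + n' = 0 := supp1 _ (top_mul deg'_inj deg'D am' bn').
have supp_a g : g \in msupp a -> g = m.
  move=> ag; apply: deg_inj; have := am.2 _ ag; have := am'.2 _ ag.
  have := am.2 _ am'.1; have := bn.2 _ bn'.1.
  have := congr1 deg mn; rewrite -mn' !degD /deg'; lia.
have aE : a = a@_m *: gr R m.
  rewrite {1}(grE a) (bigD1_seq m) ?fset_uniq ?am.1 //= big_seq_cond.
  rewrite big1 ?addr0 //.
  by move=> g /andP[/supp_a -> /eqP].
exists a@_m, m; split=> //; apply/unitrPr; exists b@_n.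
rewrite -(mcoeffM_top deg_inj degD am bn) ab1 mn.
by rewrite [LHS]mcoeffUU.
Qed.

Theorem proposition4p7 (R : idomainType) (G : zmodType)
    (hG : infinite_cyclic G) (x : grpring R G) (hx : x != 0) :
  ((exists2 N : zmodClosed G, ~ (N =i pred1 0) & princ_ideal x =i Phi R N)
   <->
   (exists (u : R) (g1 g2 : G),
      u \is a GRing.unit /\ x = u *: gr R g1 - u *: gr R g2))
  /\
  (forall (u : R) (g1 g2 : G),
     u \is a GRing.unit -> x = u *: gr R g1 - u *: gr R g2 ->
     let h := g1 - g2 in
     princ_ideal x =i Phi R (cyc h) /\
     exists f : {rmorphism algquot (princ_ideal x) -> grpring R (Quotient.quot (cyc h))},
       scalable f /\ bijective f).
Proof.
have gen u g1 g2 : u \is a GRing.unit -> x = u *: gr R g1 - u *: gr R g2 ->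
    princ_ideal x =i Phi R (cyc (g1 - g2)).
  move=> uU xE y; rewrite -(@Phi_cyclic R G (cyc (g1 - g2)) (g1 - g2)) //.
  (* x is h - 1 times the unit u g2, whose inverse is u^-1 g2^-1. *)
  have {}xE : x = (u *: gr R g2) * (gr R (g1 - g2) - 1).
    by rewrite mulrBr mulr1 -scalerAl grM [g2 + _]addrC subrK.
  have xE' : gr R (g1 - g2) - 1 = x * (u^-1 *: gr R (- g2)).
    rewrite xE mulrAC -scalerAl -scalerAr scalerA divrr // scale1r grM subrr.
    by rewrite gr0 mul1r.
  apply/asboolP/asboolP => -[c ->].
    by exists (u *: gr R g2 * c); rewrite mulrA [_ * (u *: _)]mulrC -xE.
  by exists (u^-1 *: gr R (- g2) * c); rewrite mulrA -xE'.
split; last first.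
  move=> u g1 g2 uU xE h; have xPhi := gen u g1 g2 uU xE; split=> //.
  exact: algquot_Phi.
split=> [[N _ xPhi]|[u [g1 [g2 [uU xE]]]]]; last first.
  exists [the zmodClosed G of cyc (g1 - g2)] => [cyc0|]; last exact: gen uU xE.
  have : g1 - g2 \in cyc (g1 - g2) by apply/asboolP; exists 1; rewrite mulr1z.
  rewrite cyc0 inE subr_eq0 => /eqP e.
  by move: hx; rewrite xE e subrr eqxx.
have [deg [deg_inj degD]] := infinite_cyclic_deg hG.
have [[g gG] _] := hG; have [h Nh] := sub_cyclic N gG.
have eqI y : (y \in princ_ideal x) = (y \in princ_ideal (gr R h - 1)).
  by rewrite xPhi -(Phi_cyclic Nh).
have /asboolP[b hE] : gr R h - 1 \in princ_ideal x.
  by rewrite eqI princ_ideal_gen.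
have /asboolP[a xE] : x \in princ_ideal (gr R h - 1).
  by rewrite -eqI princ_ideal_gen.
have : x * (1 - b * a) = 0 by rewrite mulrBr mulr1 mulrA -hE -xE subrr.
case/(grpring_mulf_eq0 deg_inj degD) => [x0|/subr0_eq ba1].
  by move: hx; rewrite x0 eqxx.
have [|u [k [uU aE]]] := grpring_unit (a := a) (b := b) deg_inj degD.
  by rewrite mulrC -ba1.
exists u, (h + k), k; split=> //.
by rewrite xE aE -scalerAr mulrBl grM mul1r scalerBr.
Qed.
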